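(* Let $l>0$, $\alpha\in[2,3)$, and let $c\in C^1(\mathbb R/l\mathbb Z,\mathbb R^n)$ be a curve parameterized by arc length. Then there exists a constant $C=C(\alpha)<\infty$ depending only on $\alpha$ such that $$|c'|^2_{W^{\frac{\alpha-1}2,2}}\le C\,E^\alpha(c).$$
   Context: Parameterized by arc length means $|c'|=1$ everywhere. The seminorm is $$|c'|^2_{W^{\frac{\alpha-1}2,2}}=\int_{\mathbb R/l\mathbb Z}\int_{-l/2}^{l/2}\frac{|c'(u+w)-c'(u)|^2}{|w|^\alpha}\,dw\,du .$$ The energy is $E^\alpha(c)=\iint_{(\mathbb R/l\mathbb Z)^2}\big(\frac1{|c(x)-c(y)|^\alpha}-\frac1{d_c(x,y)^\alpha}\big)|c'(x)||c'(y)|\,dx\,dy\in[0,\infty]$, where $d_c(x,y)$ is the length of the shorter arc of $c$ between $c(x)$ and $c(y)$; for arc length parameterization $$E^\alpha(c)=\int_{\mathbb R/l\mathbb Z}\int_{-l/2}^{l/2}\Big(\frac1{|c(u+w)-c(u)|^\alpha}-\frac1{|w|^\alpha}\Big)dw\,du.$$ *)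

(* Defs.v *)
From HB Require Import structures.
From mathcomp Require Import all_boot all_order all_algebra.
From mathcomp Require Import all_classical all_reals all_analysis.
Set Implicit Arguments.
Unset Strict Implicit.
Unset Printing Implicit Defensive.
Import Order.TTheory GRing.Theory Num.Theory.
Import numFieldNormedType.Exports.
Local Open Scope classical_set_scope.
Local Open Scope ring_scope.

(* The norm [`|v|] of the library on ['rV[R]_n] is the sup norm, so the
   Euclidean norm is defined here.  The two are equivalent, hence derivatives
   and continuity of curves can be taken from the library. *)
Definition enorm (R : realType) (n : nat) (v : 'rV[R]_n) : R :=
  Num.sqrt (\sum_(i < n) v ord0 i ^+ 2).

(* A map on R/lZ is an l-periodic map on R. *)
Definition C1_closed (R : realType) (n : nat) (l : R) (c : R -> 'rV[R]_n)
    : Prop :=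
  [/\ periodic c l, (forall t, derivable c t 1) & continuous (derive1 c)].

Definition arclength_param (R : realType) (n : nat) (c : R -> 'rV[R]_n)
    : Prop :=
  forall t, enorm (derive1 c t) = 1.

(* |f|^2_{W^{s,2}} for an l-periodic f; the exponent 1 + 2s equals alpha when
   s = (alpha - 1)/2.  At w = 0 the integrand is 0 by convention. *)
Definition sobolev_seminorm_sq (R : realType) (n : nat) (l s : R)
    (f : R -> 'rV[R]_n) : \bar R :=
  (\int[lebesgue_measure]_(u in `[0%R, l[)
     \int[lebesgue_measure]_(w in `[(- (l / 2))%R, (l / 2)%R])
       (enorm (f (u + w) - f u) ^+ 2 / `|w| `^ (1 + 2 * s))%:E)%E.

Definition arc_len (R : realType) (n : nat) (c : R -> 'rV[R]_n) (a b : R) : R :=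
  Rintegral lebesgue_measure `[a, b] (fun t => enorm (derive1 c t)).

(* For a <= b <= a + l, the two arcs of c joining c a and c b = c (b - l)
   are the images of [a, b] and [b, a + l]. *)
Definition curve_dist (R : realType) (n : nat) (l : R) (c : R -> 'rV[R]_n)
    (x y : R) : R :=
  let a := Num.min x y in
  let b := Num.max x y in
  Num.min (arc_len c a b) (arc_len c b (a + l)).

(* The inverses are those of the extended reals, for which 0^-1 = +oo: a
   double point of c contributes +oo.  On the diagonal x = y, which is
   negligible, the integrand has the junk value +oo - +oo = -oo. *)
Definition ohara_energy (R : realType) (n : nat) (l alpha : R)
    (c : R -> 'rV[R]_n) : \bar R :=
  (\int[lebesgue_measure]_(y in `[0%R, l[)
     \int[lebesgue_measure]_(x in `[0%R, l[)
       (((enorm (c x - c y) `^ alpha)%:E^-1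
           - (curve_dist l c x y `^ alpha)%:E^-1)
        * (enorm (derive1 c x) * enorm (derive1 c y))%:E))%E.

(* Main.v *)
(** Fix [w > 0], let [D = c(u + w) - c(u)] and let [e] be its direction.
    Comparing two unit tangents with [e] gives
    [|a - b|^2 <= 4 (1 - a.e) + 4 (1 - b.e)], and integrating along the arc
    turns the right-hand side into the chord defect:
    [int_0^(w/2) |c'(u + s + w/2) - c'(u + s)|^2 ds <= 4 (w - |D|)].
    Averaging over [u] removes the shift by [s], so the mean square
    [G(w/2)] of [c'(u + w/2) - c'(u)] satisfies
    [(w/2) G(w/2) <= 4 int (w - |D|) du], and [G(w) <= 4 G(w/2)] by the
    triangle inequality.  Hence [G(w) <= 32 int (1 - |D|/|w|) du]; weighting by
    [|w|^(-alpha)] and using [r^(-alpha) (1 - D/r) <= D^(-alpha) - r^(-alpha)]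
    for [0 <= D <= r] and [1 <= alpha] bounds the seminorm by 32 times the energy. *)
Require Import Defs.
From HB Require Import structures.
From mathcomp Require Import all_boot all_order all_algebra.
From mathcomp Require Import all_classical all_reals all_analysis.
From mathcomp Require Import measurable_realfun.
From mathcomp Require Import lra.
Import Order.TTheory GRing.Theory Num.Theory.
Import numFieldNormedType.Exports.
Local Open Scope ring_scope.

Set Implicit Arguments.
Unset Strict Implicit.
Unset Printing Implicit Defensive.

(** * Integrals of nonnegative functions: comparison, translation, Tonelli, periodicity *)

Section nonneg_integral.
Local Open Scope classical_set_scope.
Local Open Scope ereal_scope.
Context {R : realType}.
Notation mu := (@lebesgue_measure R).

(* No measurability is required, because the integral of a nonnegative
   function is a supremum over the simple functions below it. *)
Lemma ge0_le_integral_nomeas d (T : measurableType d)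
    (m : {measure set T -> \bar R}) (D : set T) (f g : T -> \bar R) :
  (forall x, D x -> 0 <= f x) -> (forall x, D x -> f x <= g x) ->
  \int[m]_(x in D) f x <= \int[m]_(x in D) g x.
Proof.
move=> f0 fg.
have g0 x : D x -> 0 <= g x by move=> Dx; exact: le_trans (f0 _ Dx) (fg _ Dx).
rewrite !ge0_integralE//; apply: le_ereal_sup => _ [h hf <-]; exists h => //.
move=> x; apply: le_trans (hf x) _; rewrite /patch.
by case: ifPn => // /set_mem; exact: fg.
Qed.

(* The negative part of [g] lives on the null set [{a}], so [g] may be
   [-oo] there, and [g] need not be measurable. *)
Lemma ge0_le_integral_off_point (D : set R) (a : R) (f g : R -> \bar R) :
  measurable D -> (forall x, D x -> 0 <= f x) ->
  (forall x, D x -> x != a -> f x <= g x) -> f a = 0 ->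
  \int[mu]_(x in D) f x <= \int[mu]_(x in D) g x.
Proof.
move=> mD f0 fg fa; rewrite [leRHS]integralE.
have gn0 : \int[mu]_(x in D) g^\- x = 0.
  apply/eqP; rewrite eq_le integral_ge0 ?andbT//.
  (* Off [a] the negative part vanishes, so it lies below [+oo] times the indicator of [[set a]],
     whose integral is [+oo * 0 = 0]. *)
  have /le_trans : \int[mu]_(x in D) g^\- x <= \int[mu]_(x in D) (cst +oo \_ [set a]) x.
    apply: ge0_le_integral_nomeas => // x Dx.
    rewrite patchE; case: ifPn => [_|]; first by rewrite leey.
    move=> xa; have {}xa : x != a by apply: contra xa => /eqP ->; rewrite inE.
    rewrite funenegE ge_max lexx andbT.
    by rewrite oppe_le0 (le_trans (f0 _ Dx) (fg _ Dx xa)).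
  apply; rewrite -integral_mkcondr integral_cst; last exact: measurableI.
  rewrite [X in _ * X](_ : _ = 0) ?mule0//.
  apply/eqP; rewrite eq_le measure_ge0 andbT -(lebesgue_measure_set1 a).
  by apply: le_measure; rewrite ?inE//; exact: measurableI.
rewrite gn0 sube0; apply: ge0_le_integral_nomeas => // x Dx.
have [->|xa] := eqVneq x a; first by rewrite fa.
by rewrite (le_trans (fg _ Dx xa))// funeposE le_max lexx.
Qed.

(** Translation pushes Lebesgue measure to a measure with the same values on half-open intervals,
    hence to Lebesgue measure itself. *)
Lemma ge0_integral_shift (D : set R) (f : R -> \bar R) (s : R) :
  measurable D -> measurable_fun [set: R] f -> (forall x, 0 <= f x) ->
  \int[mu]_(x in (fun x => (x + s)%R) @^-1` D) f (x + s)%R =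
  \int[mu]_(x in D) f x.
Proof.
move=> mD mf f0.
pose T := measurableTypeR R.
have ms : measurable_fun [set: T] (fun x : T => x + s : T)%R.
  exact: measurable_funD.
rewrite -(@ge0_integral_pushforward _ _ T T R _ ms lebesgue_measure D f)//; last first.
  exact: measurable_funTS.
pose S : {mfun T >-> T} :=
  HB.pack (fun x : T => x + s : T)%R (isMeasurableFun.Build _ _ _ _ _ ms).
apply: eq_measure_integral => A mA _.
apply/esym/(@lebesgue_measure_unique _ (pushforward mu S)) => //.
move=> _ [[a b] ab <-] /=.
rewrite /pushforward (_ : _ @^-1` _ = `](a - s)%R, (b - s)%R]%classic).
  rewrite !lebesgue_measure_itv/= !lte_fin ltrBlDr subrK -!EFinB.
  by rewrite opprB addrA subrK.
by apply/seteqP; split => x /=; rewrite !in_itv/= ltrBlDr lerBrDr.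
Qed.

(** Extension by zero outside the rectangle reduces this to Tonelli on the plane. *)
Lemma ge0_fubini_in (A B : set R) (f : R * R -> \bar R) :
  measurable A -> measurable B ->
  measurable_fun [set: R * R] f -> (forall z, 0 <= f z) ->
  \int[mu]_(x in A) \int[mu]_(y in B) f (x, y) =
  \int[mu]_(y in B) \int[mu]_(x in A) f (x, y).
Proof.
move=> mA mB mf f0; pose g := f \_ (A `*` B).
have mg : measurable_fun [set: R * R] g.
  apply/(measurable_restrictT _ _).1; first exact: measurableX.
  exact: measurable_funTS.
have g0 z : 0 <= g z by rewrite /g patchE; case: ifP.
have := @fubini_tonelli _ _ _ _ R mu mu g mg g0.
have gE x y : g (x, y) = if (x \in A) && (y \in B) then f (x, y) else 0.
  by rewrite /g patchE in_setX.
move=> H; rewrite [LHS]integral_mkcond [RHS]integral_mkcond.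
transitivity (\int[mu]_x \int[mu]_y g (x, y)); last rewrite H.
  apply: eq_integral => x _; rewrite patchE; case: ifPn => xA.
    rewrite integral_mkcond; apply: eq_integral => y _.
    by rewrite gE xA patchE.
  by rewrite integral0_eq// => y _; rewrite gE (negbTE xA).
apply: eq_integral => y _; rewrite patchE; case: ifPn => yB.
  rewrite [RHS]integral_mkcond; apply: eq_integral => x _.
  by rewrite gE yB andbT patchE.
by rewrite integral0_eq// => x _; rewrite gE (negbTE yB) andbF.
Qed.

Lemma ge0_measurable_integral_in (B : set R) (f : R * R -> \bar R) :
  measurable B -> measurable_fun [set: R * R] f -> (forall z, 0 <= f z) ->
  measurable_fun [set: R] (fun x => \int[mu]_(y in B) f (x, y)).
Proof.
move=> mB mf f0; pose g := f \_ ([set: R] `*` B).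
have mg : measurable_fun [set: R * R] g.
  apply/(measurable_restrictT _ _).1; first exact: measurableX.
  exact: measurable_funTS.
have g0 z : 0 <= g z by rewrite /g patchE; case: ifP.
have := @measurable_fun_fubini_tonelli_F _ _ _ _ R mu g mg g0.
congr measurable_fun; apply/funext => x; rewrite /fubini_F [RHS]integral_mkcond.
by apply: eq_integral => y _; rewrite /g !patchE in_setX in_setT.
Qed.

Lemma ge0_integral_split (a b c : R) (f : R -> \bar R) :
  (a <= b <= c)%R -> measurable_fun [set: R] f -> (forall x, 0 <= f x) ->
  \int[mu]_(x in `[a, c[) f x =
  \int[mu]_(x in `[a, b[) f x + \int[mu]_(x in `[b, c[) f x.
Proof.
move=> /andP[ab bc] mf f0; rewrite -ge0_integral_setU//.
- by rewrite -(@itv_bndbnd_setU _ _ (BLeft a) (BLeft b)).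
- exact: measurable_funTS.
- rewrite disj_set2E; apply/eqP/seteqP; split => // x [] /=.
  by rewrite !in_itv/= => /andP[_ xb] /andP[+ _]; rewrite leNgt xb.
Qed.

(** The two windows share [[b, a + l[], and the remaining pieces [[a, b[] and [[a + l, b + l[] are
    translates. Invariance is asked on [[a, b[] only, so that the lemma also serves functions that
    are not globally periodic, such as [deficit_density] below. *)
Lemma ge0_integral_rotate (l a b : R) (f : R -> \bar R) :
  (a <= b <= a + l)%R -> measurable_fun [set: R] f -> (forall x, 0 <= f x) ->
  (forall x, (a <= x < b)%R -> f (x + l)%R = f x) ->
  \int[mu]_(x in `[a, (a + l)%R[) f x = \int[mu]_(x in `[b, (b + l)%R[) f x.
Proof.
move=> /[dup] abl /andP[ab bal] mf f0 fl.
have bl : (b <= a + l <= b + l)%R by rewrite bal lerD2r.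
rewrite (ge0_integral_split abl)// (ge0_integral_split bl)//.
rewrite addeC; congr (_ + _).
rewrite -[RHS](@ge0_integral_shift _ _ l)//.
rewrite (_ : _ @^-1` _ = `[a, b[%classic).
  by apply: eq_integral => x; rewrite inE/= in_itv/= => /fl.
by apply/seteqP; split => x /=; rewrite !in_itv/= lerD2r ltrD2r.
Qed.

Lemma ge0_integral_period (l s : R) (f : R -> \bar R) :
  (0 <= s <= l)%R -> measurable_fun [set: R] f -> (forall x, 0 <= f x) ->
  (forall x, f (x + l)%R = f x) ->
  \int[mu]_(x in `[0%R, l[) f (x + s)%R = \int[mu]_(x in `[0%R, l[) f x.
Proof.
move=> sl mf f0 fl.
have := @ge0_integral_rotate l 0 s f; rewrite add0r => -> //.
rewrite -[RHS](@ge0_integral_shift _ _ s)//.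
rewrite (_ : _ @^-1` _ = `[0%R, l[%classic)//.
by apply/seteqP; split => x /=; rewrite !in_itv/= -lerBlDr subrr addrC ltrD2l.
Qed.

End nonneg_integral.

(** * Euclidean inner product and norm *)

Section euclidean_dot.
Context {R : realType} {n : nat}.
Implicit Types a b e v : 'rV[R]_n.

Definition dot a b : R := \sum_(i < n) a ord0 i * b ord0 i.

Lemma dotDl a b v : dot (a + b) v = dot a v + dot b v.
Proof.
by rewrite /dot -big_split/=; apply: eq_bigr => i _; rewrite mxE mulrDl.
Qed.

Lemma dotZl (k : R) a b : dot (k *: a) b = k * dot a b.
Proof. by rewrite /dot mulr_sumr; apply: eq_bigr => i _; rewrite mxE mulrA. Qed.

Lemma dotC a b : dot a b = dot b a.
Proof. by apply: eq_bigr => i _; rewrite mulrC. Qed.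

Lemma dotBl a b v : dot (a - b) v = dot a v - dot b v.
Proof. by rewrite dotDl -scaleN1r dotZl mulN1r. Qed.

Lemma dot_ge0 v : 0 <= dot v v.
Proof. by apply: sumr_ge0 => i _; rewrite -expr2 sqr_ge0. Qed.

Lemma enorm_sqr v : enorm v ^+ 2 = dot v v.
Proof.
have E : dot v v = \sum_(i < n) v ord0 i ^+ 2.
  by apply: eq_bigr => i _; rewrite expr2.
by rewrite /enorm -E sqr_sqrtr// dot_ge0.
Qed.

Lemma enorm_ge0 v : 0 <= enorm v.
Proof. exact: sqrtr_ge0. Qed.

Lemma enorm_sqr_subC a b : enorm (a - b) ^+ 2 = enorm (b - a) ^+ 2.
Proof.
rewrite !enorm_sqr /dot; apply: eq_bigr => i _; rewrite !mxE.
by rewrite -mulrNN !opprB.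
Qed.

Lemma enormN v : enorm (- v) = enorm v.
Proof.
by rewrite /enorm; congr Num.sqrt; apply: eq_bigr => i _; rewrite mxE sqrrN.
Qed.

(** The right side minus the left side is [|a + b - 2 v|^2]. *)
Lemma enorm_sqr_subD a b v :
  enorm (a - b) ^+ 2 <= 2 * enorm (a - v) ^+ 2 + 2 * enorm (v - b) ^+ 2.
Proof.
rewrite !enorm_sqr /dot !mulr_sumr -big_split/=; apply: ler_sum => i _.
rewrite !mxE.
by have := sqr_ge0 (a ord0 i + b ord0 i - 2 * v ord0 i); rewrite expr2; nra.
Qed.

(* Both unit vectors are compared with [e]:
   [|a - b|^2 <= 2 |a - e|^2 + 2 |b - e|^2]. *)
Lemma enorm_sqr_sub_unit a b e : enorm a = 1 -> enorm b = 1 -> dot e e <= 1 ->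
  enorm (a - b) ^+ 2 <= 4 * (1 - dot a e) + 4 * (1 - dot b e).
Proof.
move=> a1 b1 e1.
have dotBB v : enorm v = 1 -> enorm (v - e) ^+ 2 <= 2 * (1 - dot v e).
  move=> v1; rewrite enorm_sqr dotBl dotC dotBl [dot e (v - e)]dotC dotBl.
  by rewrite -enorm_sqr v1 [dot e v]dotC; lra.
apply: (le_trans (enorm_sqr_subD a b e)); rewrite (enorm_sqr_subC e).
by have := dotBB _ a1; have := dotBB _ b1; lra.
Qed.

(** The witness is [v / |v|]. For [v = 0] it is [0], since [0^-1 = 0]; hence [<= 1] instead of
    [= 1]. *)
Lemma enorm_dot_unit v :
  exists2 e, dot e e <= 1 & dot v e = enorm v.
Proof.
exists ((enorm v)^-1 *: v).
  rewrite dotZl dotC dotZl -enorm_sqr.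
  have [->|v0] := eqVneq (enorm v) 0; first by rewrite invr0 !mul0r.
  by rewrite expr2 mulKf// mulVf.
rewrite dotC dotZl -enorm_sqr expr2.
have [->|v0] := eqVneq (enorm v) 0; first by rewrite !mul0r mulr0.
by rewrite mulKf.
Qed.

End euclidean_dot.

(** * Chord defect of a unit-speed curve *)

Section chord.
Local Open Scope classical_set_scope.
Context {R : realType} {n : nat} (c : R -> 'rV[R]_n).
Notation mu := (@lebesgue_measure R).
Hypothesis derivable_c : forall t, derivable c t 1.
Hypothesis continuous_c' : continuous (derive1 c).

Lemma derive1_coord (i : 'I_n) (t : R) :
  is_derive t 1 (fun x => c x ord0 i) (derive1 c t ord0 i).
Proof.
have /derivable_mxP dc := @derivable_c t.
by apply: DeriveDef; [exact: dc|rewrite derive1E derive_mx// mxE].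
Qed.

Lemma continuous_coord (i : 'I_n) :
  continuous (fun x => derive1 c x ord0 i).
Proof. by move=> t; apply: (@continuous_comp _ _ _ (derive1 c) (fun M : 'rV[R]_n => M ord0 i));
  [exact: continuous_c'|exact: coord_continuous]. Qed.

Lemma is_derive_dot (e : 'rV[R]_n) (t : R) :
  is_derive t 1 (fun x => dot (c x) e) (dot (derive1 c t) e).
Proof.
rewrite (_ : (fun _ => _) = \sum_(i < n) (e ord0 i \*: fun x => c x ord0 i)).
  apply: is_derive_eq; last by apply: eq_bigr => i _; rewrite mulrC.
  apply: is_derive_sum => i; apply: is_deriveZ; exact: derive1_coord.
apply/funext => x; rewrite /dot fct_sumE; apply: eq_bigr => i _.
by rewrite mulrC.
Qed.

Lemma is_derive_shift (f : R -> R) (df s t : R) :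
  is_derive (t + s) 1 f df -> is_derive t 1 (fun x => f (x + s)) df.
Proof.
move=> fdf; have := @is_derive1_comp _ f (fun x => x + s) t df 1 fdf.
rewrite mulr1; apply; rewrite -[X in is_derive _ _ _ X]addr0.
exact: is_deriveD.
Qed.

Lemma continuous_dot (e : 'rV[R]_n) : continuous (fun x => dot (derive1 c x) e).
Proof.
apply: continuous_big; first exact: add_continuous.
by move=> i _ t; apply: cvgMr_tmp; exact: continuous_coord.
Qed.

Hypothesis unit_c' : forall t, enorm (derive1 c t) = 1.

(* With [e] the direction of the chord, the integrand is at most
   [4 (1 - c'(u+s+h).e) + 4 (1 - c'(u+s).e)], which has an explicit primitive. *)
Lemma chord_defect (u h : R) : 0 < h ->
  (\int[mu]_(s in `[0%R, h])
     (enorm (derive1 c (u + s + h) - derive1 c (u + s)) ^+ 2)%:E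
   <= (4 * (2 * h - enorm (c (u + 2 * h) - c u)))%:E)%E.
Proof.
move=> h0.
have [e e1 De] := enorm_dot_unit (c (u + 2 * h) - c u).
pose g x := dot (derive1 c x) e.
pose f (s : R) : R := 4 * (1 - g (s + (u + h))) + 4 * (1 - g (s + u)).
pose F (s : R) : R := 4 * (s - dot (c (s + (u + h))) e) + 4 * (s - dot (c (s + u)) e).
have cg (s : R) : continuous (fun x : R => g (x + s)).
  move=> x; apply: (@continuous_comp _ _ _ (fun y => y + s) g).
    by apply: cvgD; [exact: cvg_id|exact: cvg_cst].
  exact: continuous_dot.
have cf : continuous f.
  move=> x; apply: cvgD; apply: cvgMl_tmp; apply: cvgB;
    by [exact: cvg_cst|exact: cg].
have dF (s : R) : is_derive s (1 : R) F (f s).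
  have dd (a : R) :
      is_derive s (1 : R) (fun x : R => 4 * (x - dot (c (x + a)) e))
        (4 * (1 - g (s + a))).
    apply: (@is_deriveZ _ _ _ (fun x => x - dot (c (x + a)) e) 4).
    apply: (@is_deriveB _ _ _ id (fun x => dot (c (x + a)) e)).
    exact: (@is_derive_shift (fun x => dot (c x) e) _ _ _ (is_derive_dot e _)).
  exact: is_deriveD.
have cF : continuous F.
  by move=> x; apply/differentiable_continuous/derivable1_diffP; case: (dF x).
have FTC : (\int[mu]_(s in `[0%R, h]) (f s)%:E = (F h)%:E - (F 0)%:E)%E.
  apply: continuous_FTC2 => //.
  - exact: continuous_subspaceT.
  - split=> [x _||].
    + by case: (dF x).
    + exact/cvg_at_right_filter/cF.
    + exact/cvg_at_left_filter/cF.
  - by move=> x _; rewrite derive1E; case: (dF x).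
apply: (@le_trans _ _ (\int[mu]_(s in `[0%R, h]) (f s)%:E)%E).
  apply: ge0_le_integral_nomeas => s _; rewrite lee_fin ?sqr_ge0//.
  rewrite /f /g [s + u]addrC (_ : s + (u + h) = u + s + h); last by lra.
  exact: enorm_sqr_sub_unit.
rewrite FTC -EFinB lee_fin -De dotBl /F !add0r.
(* In [F h - F 0] the terms at the midpoint [u + h] cancel, which leaves the chord from [u] to
   [u + 2 * h], paired with [e]. *)
rewrite (_ : h + (u + h) = u + 2 * h); last by lra.
by rewrite [h + u]addrC; lra.
Qed.

(** The defect bounds a nonnegative integral in [chord_defect], taken at [h = w / 2], so it is
    itself nonnegative. *)
Lemma enorm_chord_le (u w : R) : 0 <= w -> enorm (c (u + w) - c u) <= w.
Proof.
rewrite le_eqVlt => /predU1P[<-|w0].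
  by rewrite addr0 subrr /enorm big1 ?sqrtr0// => i _; rewrite mxE expr0n.
have w20 : 0 < w / 2 by rewrite divr_gt0.
have := chord_defect u w20.
rewrite (_ : 2 * (w / 2) = w); last by lra.
move=> H; suff : 0 <= 4 * (w - enorm (c (u + w) - c u)) by lra.
rewrite -lee_fin; apply: le_trans H.
by apply: integral_ge0 => s _; rewrite lee_fin sqr_ge0.
Qed.

End chord.

(** * Tangent gap and chord deficit: sign, periodicity, symmetry, measurability *)

Section tangent_gap.
Local Open Scope classical_set_scope.
Context {R : realType} {n : nat} (l : R) (c : R -> 'rV[R]_n).
Notation mu := (@lebesgue_measure R).
Hypothesis periodic_c : periodic c l.
Hypothesis derivable_c : forall t, derivable c t 1.
Hypothesis continuous_c' : continuous (derive1 c).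
Hypothesis unit_c' : forall t, enorm (derive1 c t) = 1.

Definition tangent_gap (u w : R) : R :=
  enorm (derive1 c (u + w) - derive1 c u) ^+ 2.

(* Equal to [1] at [w = 0], because [x / 0 = 0]. *)
Definition chord_deficit (u w : R) : R :=
  1 - enorm (c (u + w) - c u) / `|w|.

Lemma tangent_gap_ge0 u w : 0 <= tangent_gap u w.
Proof. exact: sqr_ge0. Qed.

Lemma chord_deficit_ge0 u w : 0 <= chord_deficit u w.
Proof.
rewrite /chord_deficit subr_ge0.
have [->|w0] := eqVneq w 0; first by rewrite normr0 invr0 mulr0.
rewrite ler_pdivrMr ?normr_gt0// mul1r.
have [wge0|wlt0] := leP 0 w.
  by rewrite ger0_norm//; exact: enorm_chord_le.
(* For [w < 0] the chord is read from its other end [u + w], with the positive increment [- w]. *)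
have := @enorm_chord_le _ _ c derivable_c continuous_c' unit_c' (u + w) (- w).
rewrite addrK oppr_ge0 ltW// => /(_ isT).
by rewrite -enormN opprB ltr0_norm.
Qed.

(** Each coordinate coincides with its translate by [l], so the derivatives at [u] and at [u + l]
    agree coordinatewise. *)
Lemma derive1_periodic u : derive1 c (u + l) = derive1 c u.
Proof.
apply/matrixP => j i; have {j}-> : j = ord0 by apply/val_inj; case: j => -[].
have := is_derive_shift (derive1_coord derivable_c i (u + l)).
have -> : (fun x => c (x + l) ord0 i) = (fun x => c x ord0 i).
  by apply/funext => x; rewrite periodic_c.
move=> [_ E1]; have [_ E2] := derive1_coord derivable_c i u.
exact: etrans (esym E1) E2.
Qed.

Lemma tangent_gap_periodic u w : tangent_gap (u + l) w = tangent_gap u w.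
Proof. rewrite /tangent_gap; move: (derive1 c) derive1_periodic => f fl.
by rewrite addrAC !fl. Qed.

Lemma chord_deficit_periodic u w : chord_deficit (u + l) w = chord_deficit u w.
Proof. by rewrite /chord_deficit addrAC !periodic_c. Qed.

(** Exchanges the two ends of the arc; combined with periodicity, this reduces averages at [w < 0]
    to those at [- w]. *)
Lemma tangent_gap_shiftN u w : tangent_gap (u + w) (- w) = tangent_gap u w.
Proof. rewrite /tangent_gap; move: (derive1 c) => f.
by rewrite addrK enorm_sqr_subC. Qed.

Lemma chord_deficit_shiftN u w : chord_deficit (u + w) (- w) = chord_deficit u w.
Proof. by rewrite /chord_deficit addrK normrN -enormN opprB. Qed.

Lemma measurable_fun_tangent_gap :
  measurable_fun [set: R * R] (fun z => tangent_gap z.1 z.2).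
Proof.
under eq_fun do rewrite /tangent_gap enorm_sqr /dot.
apply: measurable_sum => i.
have m i' : measurable_fun [set: R] (fun x => derive1 c x ord0 i').
  exact: (continuous_measurable_fun (continuous_coord continuous_c' (i := i'))).
have mz : measurable_fun [set: R * R]
    (fun z => (derive1 c (z.1 + z.2) - derive1 c z.1) ord0 i).
  under eq_fun do rewrite !mxE.
  apply: measurable_funB.
    apply: (measurableT_comp (m i)); exact: measurable_funD.
  exact: (measurableT_comp (m i)).
exact: measurable_funM.
Qed.

Lemma measurable_fun_enorm_sub d (T : measurableType d) (f g : T -> R) :
  measurable_fun [set: T] f -> measurable_fun [set: T] g ->
  measurable_fun [set: T] (fun t => enorm (c (f t) - c (g t))).
Proof.
move=> mf mg; rewrite /enorm.
apply: (measurableT_comp (continuous_measurable_fun (@sqrt_continuous R))).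
apply: measurable_sum => i.
have m : measurable_fun [set: R] (fun x => c x ord0 i).
  apply: continuous_measurable_fun => x.
  apply/differentiable_continuous/derivable1_diffP.
  by case: (derive1_coord derivable_c i x).
apply: measurable_funX; under eq_fun do rewrite !mxE.
by apply: measurable_funB; apply: (measurableT_comp m).
Qed.

Lemma measurable_fun_chord_deficit :
  measurable_fun [set: R * R] (fun z => chord_deficit z.1 z.2).
Proof.
rewrite /chord_deficit; apply: measurable_funB => //.
apply: measurable_funM.
  by apply: measurable_fun_enorm_sub => //; exact: measurable_funD.
rewrite (_ : (fun z : R * R => `|z.2|^-1) = fun z => `|z.2| `^ (-1)).
  apply: (measurableT_comp (measurable_powR (-1))).
  exact: measurableT_comp.
by apply/funext => z; rewrite powR_inv1.
Qed.

End tangent_gap.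

(** * Averaging over the base point *)

Lemma measurable_slicel {R : realType} (f : R -> R -> R) (w : R) :
  measurable_fun [set: R * R]%classic (fun z => (f z.1 z.2)%:E) ->
  measurable_fun [set: R]%classic (fun u => (f u w)%:E).
Proof.
move=> mf; apply: (measurableT_comp mf (g := fun u => (u, w))).
exact: measurable_fun_pair.
Qed.

(* [q u w] stands for [|c'(u + w) - c'(u)|^2] and [d u w] for
   [1 - |c(u + w) - c(u)| / |w|]; [q_chord] is the estimate [chord_defect]. *)
Section averaging.
Local Open Scope classical_set_scope.
Context {R : realType} (l : R) (q d : R -> R -> R).
Notation mu := (@lebesgue_measure R).
Hypothesis q_ge0 : forall u w, 0 <= q u w.
Hypothesis d_ge0 : forall u w, 0 <= d u w.
Hypothesis q_periodic : forall u w, q (u + l) w = q u w.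
Hypothesis d_periodic : forall u w, d (u + l) w = d u w.
Hypothesis mq : measurable_fun [set: R * R] (fun z => (q z.1 z.2)%:E).
Hypothesis md : measurable_fun [set: R * R] (fun z => (d z.1 z.2)%:E).
Hypothesis q_shiftN : forall u w, q (u + w) (- w) = q u w.
Hypothesis d_shiftN : forall u w, d (u + w) (- w) = d u w.
Hypothesis q_double :
  forall u h, q u (2 * h) <= 2 * q (u + h) h + 2 * q u h.
Hypothesis q_chord : forall u h, 0 < h ->
  (\int[mu]_(s in `[0%R, h]) (q (u + s) h)%:E <= (8 * h * d u (2 * h))%:E)%E.

Let mq1 w : measurable_fun [set: R] (fun u => (q u w)%:E).
Proof. exact: measurable_slicel. Qed.

Let md1 w : measurable_fun [set: R] (fun u => (d u w)%:E).
Proof. exact: measurable_slicel. Qed.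

(** By periodicity, the shift of [u] by [h] does not change the average, so both terms of [q_double]
    contribute twice the same integral. *)
Lemma average_double (h : R) : 0 <= h <= l ->
  (\int[mu]_(u in `[0%R, l[) (q u (2 * h))%:E
   <= 4%:E * \int[mu]_(u in `[0%R, l[) (q u h)%:E)%E.
Proof.
move=> hl.
apply: (@le_trans _ _
    (\int[mu]_(u in `[0%R, l[) (2%:E * (q (u + h) h)%:E + 2%:E * (q u h)%:E))%E).
  apply: ge0_le_integral_nomeas => u _; first by rewrite lee_fin q_ge0.
  by rewrite -!EFinM -EFinD lee_fin.
have m2 : measurable_fun [set: R] (fun u => (q (u + h) h)%:E).
  apply: (measurableT_comp (mq1 h)); exact: measurable_funD.
rewrite ge0_integralD//=; last 4 first.
- by move=> u _; rewrite -EFinM lee_fin mulr_ge0.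
- by apply: measurable_funTS; apply: measurable_funeM; exact: m2.
- by move=> u _; rewrite -EFinM lee_fin mulr_ge0.
- by apply: measurable_funTS; apply: measurable_funeM; exact: mq1.
rewrite !ge0_integralZl//=;
  try solve [by move=> u _; rewrite lee_fin | apply: measurable_funTS;
             first [exact: m2 | exact: mq1]].
rewrite (@ge0_integral_period _ l h (fun u => (q u h)%:E))//; last 2 first.
- by move=> u; rewrite lee_fin.
- by move=> u; rewrite q_periodic.
rewrite -ge0_muleDl// -EFinD; apply: lee_wpmul2r.
  by apply: integral_ge0 => u _; rewrite lee_fin.
by rewrite lee_fin; lra.
Qed.

(** The average does not change when [u] is shifted by [s], so [h] times it is a double integral
    over [s] in [[0, h]] and [u]. After exchanging the order, [q_chord] bounds the integral in [s]
    for each fixed [u]. *)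
Lemma average_chord (h : R) : 0 < h <= l ->
  (h%:E * \int[mu]_(u in `[0%R, l[) (q u h)%:E
   <= (8 * h)%:E * \int[mu]_(u in `[0%R, l[) (d u (2 * h))%:E)%E.
Proof.
move=> /andP[h0 hl].
have m2 : measurable_fun [set: R * R] (fun z => (q (z.1 + z.2) h)%:E).
  apply: (measurableT_comp (mq1 h)); exact: measurable_funD.
have -> : (h%:E * \int[mu]_(u in `[0%R, l[) (q u h)%:E =
    \int[mu]_(s in `[0%R, h]) \int[mu]_(u in `[0%R, l[) (q (u + s) h)%:E)%E.
  transitivity (\int[mu]_(s in `[0%R, h])
      cst (\int[mu]_(u in `[0%R, l[) (q u h)%:E) s)%E.
    rewrite integral_cst// [X in _ = (_ * X)%E](_ : _ = h%:E) 1?muleC//.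
    by apply: etrans (lebesgue_measure_itv _) _; rewrite /= lte_fin h0 sube0.
  apply: eq_integral => s; rewrite inE/= in_itv/= => /andP[s0 sh].
  rewrite (@ge0_integral_period _ l s (fun u => (q u h)%:E))//.
  - by rewrite s0 (le_trans sh).
  - by move=> u; rewrite lee_fin.
  - by move=> u; rewrite q_periodic.
rewrite -(@ge0_fubini_in _ _ _ (fun z => (q (z.1 + z.2) h)%:E))//; last first.
  by move=> z; rewrite lee_fin.
rewrite -ge0_integralZl//=; last 3 first.
- by apply: measurable_funTS; exact: md1.
- by move=> u _; rewrite lee_fin.
- by rewrite lee_fin mulr_ge0// ltW.
apply: ge0_le_integral_nomeas => u _.
  by apply: integral_ge0 => s _; rewrite lee_fin.
by rewrite -EFinM; exact: q_chord.
Qed.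

(** Take [w = 2 * h]: doubling costs a factor 4, and the chord estimate a factor 8 once the positive
    finite [h] is cancelled, whence 32. *)
Let average_le_gt0 (w : R) : 0 < w <= l ->
  (\int[mu]_(u in `[0%R, l[) (q u w)%:E
   <= 32%:E * \int[mu]_(u in `[0%R, l[) (d u w)%:E)%E.
Proof.
move=> /andP[w0 wl].
have [h hw h0] : exists2 h, w = 2 * h & 0 < h by exists (w / 2); lra.
have hl : h <= l by lra.
have := @average_double h; rewrite ltW//= => /(_ hl).
rewrite -hw => /le_trans; apply.
have := @average_chord h; rewrite h0 hl -hw => /(_ isT).
rewrite [(8 * h)%R]mulrC EFinM -muleA lee_pmul2l// => H.
rewrite (_ : 32%:E = 4%:E * 8%:E)%E; last by rewrite -EFinM; congr EFin; lra.
by rewrite -muleA; apply: lee_wpmul2l.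
Qed.

Lemma average_le (w : R) : 0 < `|w| <= l ->
  (\int[mu]_(u in `[0%R, l[) (q u w)%:E
   <= 32%:E * \int[mu]_(u in `[0%R, l[) (d u w)%:E)%E.
Proof.
have [w0|w0|<-] := ltgtP 0 w; last by rewrite normr0 ltxx.
  by rewrite gtr0_norm//; exact: average_le_gt0.
rewrite ltr0_norm// => wl.
(* Translating [u] by [- w], which lies in []0, l]], and exchanging ends replaces [w] by [- w] in
   both averages. *)
have period (f : R -> R -> R) :
    (forall u w, 0 <= f u w) -> (forall u w, f (u + l) w = f u w) ->
    measurable_fun [set: R] (fun u => (f u w)%:E) ->
    (forall u w, f (u + w) (- w) = f u w) ->
    (\int[mu]_(u in `[0%R, l[) (f u w)%:E =
     \int[mu]_(u in `[0%R, l[) (f u (- w))%:E)%E.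
  move=> f0 fl mf fN.
  rewrite -(@ge0_integral_period _ l (- w) (fun u => (f u w)%:E))//.
  - by apply: eq_integral => u _; rewrite -[in LHS](fN _ w) subrK.
  - by move/andP : wl => [/ltW -> ->].
  - by move=> u; rewrite lee_fin.
  - by move=> u; rewrite fl.
by rewrite !period//; exact: average_le_gt0.
Qed.

(** With [w] outermost the weight [k w] leaves the integral in [u], and [average_le] applies for
    each [w]; Tonelli then restores the order. *)
Lemma weighted_average_le (A : set R) (k : R -> R) :
  measurable A -> (forall w, A w -> `|w| <= l) ->
  measurable_fun [set: R] k -> (forall w, 0 <= k w) -> k 0 = 0 ->
  (\int[mu]_(u in `[0%R, l[) \int[mu]_(w in A) (q u w * k w)%:E
   <= 32%:E * \int[mu]_(u in `[0%R, l[) \int[mu]_(w in A) (d u w * k w)%:E)%E.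
Proof.
move=> mA Al mk k0 k00.
have mfk (f : R -> R -> R) : measurable_fun [set: R * R] (fun z => (f z.1 z.2)%:E) ->
    measurable_fun [set: R * R] (fun z => (f z.1 z.2 * k z.2)%:E).
  move=> /measurable_EFinP mf; apply/measurable_EFinP; apply: measurable_funM => //.
  exact: (measurableT_comp mk).
have dk0 u w : (0 <= (d u w * k w)%:E)%E by rewrite lee_fin mulr_ge0.
have m32 := measurable_funeM 32%:E (mfk _ md).
rewrite (@ge0_fubini_in _ _ _ (fun z => (q z.1 z.2 * k z.2)%:E))//=; last 2 first.
- exact: mfk.
- by move=> z; rewrite lee_fin mulr_ge0.
apply: (@le_trans _ _
  (\int[mu]_(w in A) \int[mu]_(u in `[0%R, l[) (32%:E * (d u w * k w)%:E))%E).
  apply: ge0_le_integral_nomeas => w Aw.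
    by apply: integral_ge0 => u _; rewrite lee_fin mulr_ge0.
  have pull (f : R -> R -> R) : (forall u w, 0 <= f u w) ->
      measurable_fun [set: R] (fun u => (f u w)%:E) ->
      (\int[mu]_(u in `[0%R, l[) (f u w * k w)%:E =
       (k w)%:E * \int[mu]_(u in `[0%R, l[) (f u w)%:E)%E.
    move=> f0 mf; rewrite -ge0_integralZl//=.
    - by apply: eq_integral => u _; rewrite -EFinM mulrC.
    - by apply: measurable_funTS; exact: mf.
    - by move=> u _; rewrite lee_fin.
    - by rewrite lee_fin.
  rewrite ge0_integralZl//=; last first.
    apply: measurable_funTS; exact: (@measurable_slicel R (fun u w => d u w * k w) w (mfk _ md)).
  (* [average_le] says nothing at [w = 0]; there [k 0 = 0] makes both sides vanish. *)
  rewrite !pull//; have [->|w0] := eqVneq w 0.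
    by rewrite k00 !mul0e mule0.
  rewrite muleCA; apply: lee_wpmul2l; first by rewrite lee_fin.
  by apply: average_le; rewrite normr_gt0 w0 Al.
rewrite -(@ge0_fubini_in _ _ _ (fun z => (32%:E * (d z.1 z.2 * k z.2)%:E)%E))//=; last first.
  by move=> z; rewrite mule_ge0.
rewrite -ge0_integralZl//=; last 2 first.
- apply: measurable_funTS.
  exact: (@ge0_measurable_integral_in _ A (fun z => (d z.1 z.2 * k z.2)%:E) mA (mfk _ md)).
- by move=> u _; apply: integral_ge0.
apply: ge0_le_integral_nomeas => u _.
  by apply: integral_ge0 => w _; rewrite mule_ge0.
rewrite ge0_integralZl//=.
apply: measurable_funTS.
apply: (measurableT_comp (mfk _ md) (g := fun w => (u, w))).
exact: measurable_fun_pair.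
Qed.

End averaging.

(** Put [rho = D / r <= 1]. Since [1 <= alpha], [D^alpha <= rho * r^alpha], so for [0 < D] the claim
    follows from [1 - rho <= 1 / rho - 1]. *)
Lemma energy_density_ge {R : realType} (alpha D r e1 e2 : R) : 1 <= alpha ->
  0 <= D <= r -> 0 < r -> e1 = 1 -> e2 = 1 ->
  (((1 - D / r) * (r `^ alpha)^-1)%:E <=
   ((D `^ alpha)%:E^-1 - (r `^ alpha)%:E^-1) * (e1 * e2)%:E)%E.
Proof.
move=> alpha1 /andP[D0 Dr] r0 -> ->; rewrite mulr1 mule1.
have P0 : 0 < r `^ alpha by exact: powR_gt0.
rewrite [X in (_ - X)%E]inver gt_eqF//.
(* At a double point the extended inverse of [0] is [+oo], and a finite number is subtracted from
   it. *)
have [->|Dneq0] := eqVneq D 0.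
  rewrite powR0 ?gt_eqF ?(lt_le_trans _ alpha1)// inve0.
  by rewrite addye// leey.
have {}D0 : 0 < D by rewrite lt_neqAle eq_sym Dneq0.
have Q0 : 0 < D `^ alpha by exact: powR_gt0.
rewrite inver gt_eqF// -EFinB lee_fin.
have rho0 : 0 < D / r by rewrite divr_gt0.
have rho1 : D / r <= 1 by rewrite ler_pdivrMr// mul1r.
have : D `^ alpha <= D / r * r `^ alpha.
  by rewrite -[X in X `^ _ <= _](divfK (lt0r_neq0 r0)) ge1r_powRZ ?rho0 ?rho1// ltW.
move: (D / r) (D `^ alpha) (r `^ alpha) rho0 rho1 P0 Q0 => rho Q P rho0 rho1 P0 Q0 QP.
(* Clearing denominators leaves [(2 - rho) * Q <= P]. *)
rewrite lerBrDr -[X in _ + X]mul1r -mulrDl ler_pdivrMr// mulrC.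
rewrite ler_pdivlMr//.
(* [(2 - rho) rho <= 1], a square. *)
have := sqr_ge0 (1 - rho); rewrite expr2 => H.
have : (1 - rho + 1) * Q <= (1 - rho + 1) * (rho * P) by rewrite ler_wpM2l//; lra.
move=> /le_trans; apply.
have : 0 <= P * ((1 - rho) * (1 - rho)) by rewrite mulr_ge0// ltW.
by lra.
Qed.

(** * Bound of the seminorm by the weighted chord deficit *)

Section energy_lower_bound.
Local Open Scope classical_set_scope.
Context {R : realType} {n : nat} (l : R) (c : R -> 'rV[R]_n).
Notation mu := (@lebesgue_measure R).
Hypothesis periodic_c : periodic c l.
Hypothesis derivable_c : forall t, derivable c t 1.
Hypothesis continuous_c' : continuous (derive1 c).
Hypothesis unit_c' : forall t, enorm (derive1 c t) = 1.

Lemma sobolev_seminorm_sq_le (s : R) : 0 < 1 + 2 * s ->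
  (sobolev_seminorm_sq l s (derive1 c) <=
   32%:E * \int[mu]_(u in `[0%R, l[) \int[mu]_(w in `[(- (l / 2))%R, (l / 2)%R])
     (chord_deficit c u w * (`|w| `^ (1 + 2 * s))^-1)%:E)%E.
Proof.
move=> s0.
have mk : measurable_fun [set: R] (fun w : R => (`|w| `^ (1 + 2 * s))^-1).
  under eq_fun do rewrite -powRN.
  apply: (measurableT_comp (measurable_powR _)); exact: normr_measurable.
(* The exponent is nonzero, so the power is [0] at [w = 0], and [0^-1 = 0] in the field: the weight
   vanishes there. *)
have k00 : (`|0 : R| `^ (1 + 2 * s))^-1 = 0.
  by rewrite normr0 powR0 ?gt_eqF// invr0.
have qd u h : tangent_gap c u (2 * h) <=
    2 * tangent_gap c (u + h) h + 2 * tangent_gap c u h.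
  rewrite /tangent_gap; move: (derive1 c) => f.
  rewrite (_ : u + 2 * h = u + h + h); last by lra.
  exact: enorm_sqr_subD.
have qc u h : 0 < h -> (\int[mu]_(s in `[0%R, h]) (tangent_gap c (u + s) h)%:E
    <= (8 * h * chord_deficit c u (2 * h))%:E)%E.
  (* Only normalization remains: [8 * h * (1 - D / (2 * h)) = 4 * (2 * h - D)]. *)
  move=> h0; apply: (le_trans (chord_defect derivable_c continuous_c' unit_c' u h0)).
  rewrite lee_fin /chord_deficit gtr0_norm ?mulr_gt0//.
  move: (enorm _) => D; rewrite [leRHS]mulrBr mulr1.
  rewrite (_ : 8 * h * (D / (2 * h)) = 4 * D); first by lra.
  rewrite (_ : 8 * h = 4 * (2 * h)); last by lra.
  by rewrite -mulrA [2 * h * _]mulrC divfK// mulf_neq0// gt_eqF.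
(* A point of this interval forces [0 <= l], hence [l / 2 <= l]. *)
have Al w : `[(- (l / 2))%R, (l / 2)%R]%classic w -> `|w| <= l.
  by rewrite /= in_itv/= ler_norml => /andP[? ?]; apply/andP; split; lra.
have mq : measurable_fun [set: R * R] (fun z => (tangent_gap c z.1 z.2)%:E).
  by apply/measurable_EFinP; exact: measurable_fun_tangent_gap.
have md : measurable_fun [set: R * R] (fun z => (chord_deficit c z.1 z.2)%:E).
  by apply/measurable_EFinP; exact: measurable_fun_chord_deficit.
have k_ge0 (w : R) : 0 <= (`|w| `^ (1 + 2 * s))^-1 by rewrite invr_ge0 powR_ge0.
exact: (weighted_average_le (tangent_gap_ge0 c)
  (chord_deficit_ge0 derivable_c continuous_c' unit_c')
  (tangent_gap_periodic periodic_c derivable_c)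
  (chord_deficit_periodic periodic_c) mq md (tangent_gap_shiftN c)
  (chord_deficit_shiftN c) qd qc (measurable_itv _) Al mk k_ge0 k00).
Qed.

End energy_lower_bound.

(** * From the weighted chord deficit to the energy *)

Section energy_integral.
Local Open Scope classical_set_scope.
Context {R : realType} {n : nat} (l alpha : R) (c : R -> 'rV[R]_n).
Notation mu := (@lebesgue_measure R).
Hypothesis l_gt0 : 0 < l.
Hypothesis alpha_ge1 : 1 <= alpha.
Hypothesis periodic_c : periodic c l.
Hypothesis derivable_c : forall t, derivable c t 1.
Hypothesis continuous_c' : continuous (derive1 c).
Hypothesis unit_c' : forall t, enorm (derive1 c t) = 1.

Lemma arc_len_unit (a b : R) : a <= b -> arc_len c a b = b - a.
Proof.
move=> ab; rewrite /arc_len (@eq_Rintegral _ _ _ _ _ (cst 1)); last first.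
  by move=> t _; exact: unit_c'.
rewrite Rintegral_cst// mul1r.
rewrite [X in fine X](_ : _ = (b - a)%:E)//.
apply: etrans (lebesgue_measure_itv _) _; rewrite /= lte_fin.
by case: ltgtP ab => // -> _; rewrite subrr.
Qed.

(* Agrees with the distance to [0] on the circle only for [|t| <= l]. *)
Definition circle_norm (t : R) : R := Num.min `|t| `|l - `|t| |.

(** On this range the translation by [l] swaps the two arguments of the minimum. *)
Lemma circle_normD (t : R) : - l <= t <= 0 -> circle_norm (t + l) = circle_norm t.
Proof.
move=> /andP[lt t0]; rewrite /circle_norm (@ler0_norm _ t)// (@ger0_norm _ (t + l)); last by lra.
by rewrite minC !ger0_norm//; [congr Num.min; lra|lra|lra].
Qed.

Lemma circle_norm_small (t : R) : `|t| <= l / 2 -> circle_norm t = `|t|.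
Proof.
suff min_l_sub (r : R) : 0 < l -> r <= l / 2 -> Num.min r `|l - r| = r.
  exact: min_l_sub.
move=> l0 rl; have lr : 0 <= l - r by lra.
by rewrite min_l// ger0_norm//; lra.
Qed.

Lemma circle_norm_gt0 (x y : R) : 0 <= x < l -> 0 <= y < l -> x != y ->
  0 < circle_norm (x - y).
Proof.
move=> /andP[x0 xl] /andP[y0 yl] xy; rewrite /circle_norm lt_min normr_gt0 subr_eq0 xy/=.
by rewrite normr_gt0 subr_eq0 gt_eqF// ltr_norml; apply/andP; split; lra.
Qed.

(** At unit speed the two arcs have lengths [|x - y|] and [l - |x - y|]. *)
Lemma curve_dist_unit (x y : R) : 0 <= x < l -> 0 <= y < l ->
  curve_dist l c x y = circle_norm (x - y).
Proof.
move=> /andP[x0 xl] /andP[y0 yl]; rewrite /curve_dist /circle_norm.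
have [xy|yx] := leP x y.
  rewrite !arc_len_unit//; last by lra.
  by rewrite distrC (@ger0_norm _ (y - x)) ?ger0_norm; [congr Num.min; lra|lra|lra].
rewrite !arc_len_unit//; [|lra|exact: ltW].
by rewrite (@ger0_norm _ (x - y)) ?ger0_norm; [congr Num.min; lra|lra|lra].
Qed.

Lemma enorm_sub_le (x y : R) : enorm (c x - c y) <= `|x - y|.
Proof.
have chord a b : a <= b -> enorm (c b - c a) <= b - a.
  move=> ab; have := enorm_chord_le derivable_c continuous_c' unit_c' a (w := b - a).
  by rewrite subr_ge0 (addrC a) subrK; apply.
have [xy|yx] := leP x y.
  rewrite -enormN opprB distrC (@ger0_norm _ (y - x)) ?subr_ge0//.
  exact: chord.
move/ltW in yx; rewrite (@ger0_norm _ (x - y)) ?subr_ge0//.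
exact: chord.
Qed.

(** The second bound comes from moving the smaller parameter forward by one period. *)
Lemma enorm_sub_le_circle (x y : R) : enorm (c x - c y) <= circle_norm (x - y).
Proof.
rewrite /circle_norm le_min enorm_sub_le/=.
have [xy|yx] := leP x y.
  rewrite -(periodic_c x) (le_trans (enorm_sub_le _ _))//.
  by rewrite (@ler0_norm _ (x - y)) 1?(_ : x + l - y = l - - (x - y))//; lra.
rewrite -(periodic_c y) (le_trans (enorm_sub_le _ _))//.
by rewrite (@ger0_norm _ (x - y)) 1?distrC 1?(_ : y + l - x = l - (x - y))//; lra.
Qed.

(** The weighted deficit at [w = x - y], with [|w|] replaced by the distance on the circle: it is
    compared with the energy integrand on the square [[0, l[ x [0, l[], where [|x - y|] may exceed
    [l / 2]. *)
Definition deficit_density (y x : R) : R :=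
  (1 - enorm (c x - c y) / circle_norm (x - y)) * (circle_norm (x - y) `^ alpha)^-1.

Lemma deficit_density_ge0 y x : 0 <= deficit_density y x.
Proof.
rewrite /deficit_density mulr_ge0 ?invr_ge0 ?powR_ge0// subr_ge0.
have : 0 <= circle_norm (x - y) by rewrite le_min !normr_ge0.
rewrite le_eqVlt => /predU1P[<-|r0]; first by rewrite invr0 mulr0.
by rewrite ler_pdivrMr// mul1r enorm_sub_le_circle.
Qed.

Lemma measurable_fun_deficit_density y :
  measurable_fun [set: R] (deficit_density y).
Proof.
have mr : measurable_fun [set: R] (fun x => circle_norm (x - y)).
  apply: measurable_minr.
    by apply: measurableT_comp => //; exact: measurable_funB.
  apply: measurableT_comp => //; apply: measurable_funB => //.
  by apply: measurableT_comp => //; exact: measurable_funB.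
have mpow p : measurable_fun [set: R] (fun x => circle_norm (x - y) `^ p).
  exact: (measurableT_comp (measurable_powR p)).
rewrite /deficit_density; apply: measurable_funM; last first.
  by under eq_fun do rewrite -powRN; exact: mpow.
apply: measurable_funB => //; apply: measurable_funM; last first.
  under eq_fun do rewrite -powR_inv1 ?le_min ?normr_ge0//; exact: mpow.
by apply: (measurable_fun_enorm_sub derivable_c) => //; exact: measurable_cst.
Qed.

(** This value, due to [0^-1 = 0], is what [ge0_le_integral_off_point] asks at the exceptional
    point. *)
Lemma deficit_density_diag y : deficit_density y y = 0.
Proof.
have l0 := l_gt0; have alpha1 := alpha_ge1.
rewrite /deficit_density /circle_norm (subrr y) normr0 min_l//.
by rewrite powR0 ?invr0 ?mulr0// gt_eqF//; lra.
Qed.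

Lemma deficit_density_periodic (x y : R) : - l <= x - y <= 0 ->
  deficit_density y (x + l) = deficit_density y x.
Proof.
by move=> xy; rewrite /deficit_density periodic_c (addrAC x) circle_normD.
Qed.

(** Substituting [x = y + w] gives a window of length [l] centred at [y], which is then rotated to
    [[0, l[]. *)
Lemma integral_deficit_density (y : R) : 0 <= y < l ->
  (\int[mu]_(w in `[(- (l / 2))%R, (l / 2)%R])
     (chord_deficit c y w * (`|w| `^ alpha)^-1)%:E =
   \int[mu]_(x in `[0%R, l[) (deficit_density y x)%:E)%E.
Proof.
move=> /andP[y0 yl].
have mD : measurable_fun [set: R] (fun x => (deficit_density y x)%:E).
  by apply/measurable_EFinP; exact: measurable_fun_deficit_density.
have D0 x : (0 <= (deficit_density y x)%:E)%E.
  by rewrite lee_fin deficit_density_ge0.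
transitivity (\int[mu]_(w in `[(- (l / 2))%R, (l / 2)%R]) (deficit_density y (w + y))%:E)%E.
  apply: eq_integral => w; rewrite inE/= in_itv/= -ler_norml => wl.
  rewrite /deficit_density addrK circle_norm_small// [w + y]addrC.
  by [].
rewrite -integral_itv_bndo_bndc; last first.
  apply: measurable_funTS; apply: (measurableT_comp mD).
  exact: measurable_funD.
pose a := y - l / 2.
transitivity (\int[mu]_(x in `[a, (a + l)%R[) (deficit_density y x)%:E)%E.
  rewrite -[RHS](@ge0_integral_shift _ _ (fun x => (deficit_density y x)%:E) y)//.
  rewrite (_ : _ @^-1` _ = `[(- (l / 2))%R, (l / 2)%R[%classic)//.
  by apply/seteqP; split => x /=; rewrite !in_itv/= /a => /andP[? ?]; apply/andP; split; lra.
(* [ge0_integral_rotate] moves a window to the right, so the sign of [a] decides which window is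
   moved. Either way the moved points satisfy [- l <= x - y <= 0]. *)
have [ya|ay] := leP a 0.
  rewrite (@ge0_integral_rotate _ l a 0) ?add0r//.
    by rewrite ya/= /a; have := l_gt0; lra.
  move=> x /andP[ax x0]; rewrite deficit_density_periodic//.
  by move: ax; rewrite /a => ax; apply/andP; split; have := l_gt0; lra.
rewrite -(@ge0_integral_rotate _ l 0 a) ?add0r//.
  by rewrite ltW//= /a; have := l_gt0; lra.
move=> x /andP[x0 xa]; rewrite deficit_density_periodic//.
by move: xa; rewrite /a => xa; apply/andP; split; have := l_gt0; lra.
Qed.

(** For each [y] both inner integrals now run over [x] in [[0, l[], and [energy_density_ge] compares
    the integrands. *)
Lemma ohara_energy_ge :
  (\int[mu]_(y in `[0%R, l[) \int[mu]_(w in `[(- (l / 2))%R, (l / 2)%R])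
     (chord_deficit c y w * (`|w| `^ alpha)^-1)%:E <= ohara_energy l alpha c)%E.
Proof.
apply: ge0_le_integral_nomeas => y.
  move=> _; apply: integral_ge0 => w _.
  by rewrite lee_fin mulr_ge0 ?invr_ge0 ?powR_ge0//; exact: chord_deficit_ge0.
rewrite /= in_itv/= => yl; rewrite integral_deficit_density//.
(* The point [x = y] is set apart because the energy integrand is [-oo] there. *)
apply: (@ge0_le_integral_off_point _ _ y) => //.
- by move=> x _; rewrite lee_fin deficit_density_ge0.
- move=> x; rewrite /= in_itv/= => xl xy.
  rewrite curve_dist_unit//; apply: energy_density_ge => //.
  + by rewrite enorm_ge0 enorm_sub_le_circle.
  + exact: circle_norm_gt0.
- by rewrite deficit_density_diag.
Qed.

End energy_integral.

Theorem theorem3p2 (R : realType) (alpha : R) (halpha : 2 <= alpha < 3) :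
  exists C : R,
    forall (l : R) (n : nat) (c : R -> 'rV[R]_n),
      0 < l -> C1_closed l c -> arclength_param c ->
      (sobolev_seminorm_sq l ((alpha - 1) / 2) (derive1 c)
         <= C%:E * ohara_energy l alpha c)%E.
Proof.
have /andP[alpha2 _] := halpha.
exists 32 => l n c l0 [periodic_c derivable_c continuous_c'] unit_c'.
(* The smoothness [(alpha - 1) / 2] makes the seminorm weight the power [alpha] of the energy. *)
have alphaE : 1 + 2 * ((alpha - 1) / 2) = alpha by lra.
have := @sobolev_seminorm_sq_le _ _ l c periodic_c derivable_c continuous_c'
  unit_c' ((alpha - 1) / 2).
rewrite alphaE => /(_ _)/le_trans; apply; first by lra.
apply: lee_wpmul2l; first by rewrite lee_fin.
by apply: ohara_energy_ge => //; lra.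
Qed.
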